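(* The Taylor expansion of $\tilde\omega(u)$ is given by $$\tilde\omega(u)=W\sum_{n=0}^\infty\frac{\rho(n)}{(2n)!}\,\Omega^n\,u^{2n}\qquad(|u|<1),$$ where $\rho(n)$ are numbers defined in terms of the sequence $(\delta(n))_{n=0}^\infty$ as $$\rho(n)=\frac1{16}\Big(4\Omega\,\delta(n+1)-(32n^2+8n+3)\,\delta(n)+(2n-1)(2n)(4n-1)(4n-3)\,\Omega^{-1}\,\delta(n-1)\Big)$$ (for $n=0$ the last term, which has the factor $2n=0$, is taken to be $0$).
   Context: For $x>0$ let $\omega(x)=\sum_{m=1}^\infty(2\pi^2m^4x^2-3\pi m^2x)e^{-\pi m^2x}$ and $\theta(x)=\sum_{m=-\infty}^\infty e^{-\pi m^2x}$. For $|u|<1$ define $$\tilde\omega(u)=\frac{1}{\sqrt{1+u}}\,\omega\left(\frac{1-u}{1+u}\right),\qquad\tilde\theta(u)=\frac{1}{\sqrt{1+u}}\,\theta\left(\frac{1-u}{1+u}\right).$$ Constants: $$W=\theta(1)=\frac{\Gamma\left(\frac14\right)}{\sqrt2\,\pi^{3/4}},\qquad\Omega=\frac{\Gamma\left(\frac14\right)^8}{128\,\pi^4}.$$ The sequence $(\delta(n))_{n\ge0}=1,1,-1,51,849,-26199,1341999,\ldots$ is the sequence (known to consist of integers) determined by the Taylor expansion $$\tilde\theta(u)=W\sum_{n=0}^\infty\frac{\delta(n)}{(2n)!}\,\Omega^n\,u^{2n}\qquad(|u|<1).$$ *)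

(* Defs.v *)
From Stdlib Require Import Reals ZArith.
From Coquelicot Require Import Coquelicot.
Open Scope R_scope.

(** Sum over all integers, split as m = 0, 1, 2, ... and m = -1, -2, ...;
    it is only used on absolutely convergent families. *)
Definition ZSeries (a : Z -> R) : R :=
  Series (fun k : nat => a (Z.of_nat k))
  + Series (fun k : nat => a (- Z.of_nat (S k))%Z).

Definition theta (x : R) : R :=
  ZSeries (fun m => exp (- PI * IZR m ^ 2 * x)).

(** The summation index is m = k + 1. *)
Definition omega (x : R) : R :=
  Series (fun k : nat =>
    let m := INR (S k) in
    (2 * PI ^ 2 * m ^ 4 * x ^ 2 - 3 * PI * m ^ 2 * x)
    * exp (- PI * m ^ 2 * x)).

Definition tilde (f : R -> R) (u : R) : R :=
  / sqrt (1 + u) * f ((1 - u) / (1 + u)).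

Definition omega_tilde : R -> R := tilde omega.
Definition theta_tilde : R -> R := tilde theta.

(** Euler's integral, meaningful for [s > 0]; it is improper at both ends. *)
Definition Gamma (s : R) : R :=
  RInt_gen (fun t => Rpower t (s - 1) * exp (- t))
    (at_right 0) (Rbar_locally p_infty).

(** In closed form, W = Gamma (1/4) / (sqrt 2 * PI^(3/4)). *)
Definition W : R := theta 1.

Definition Omega : R := Gamma (1 / 4) ^ 8 / (128 * PI ^ 4).

Definition taylor_term (c : nat -> R) (u : R) (n : nat) : R :=
  c n / INR (fact (2 * n)) * Omega ^ n * u ^ (2 * n).

(** Convergence is stated separately because [Series] is total. *)
Definition has_taylor_expansion (f : R -> R) (c : nat -> R) : Prop :=
  forall u : R, Rabs u < 1 ->
    ex_series (taylor_term c u) /\ f u = W * Series (taylor_term c u).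

(** At [n = 0] the truncated [n - 1] is harmless: the factor [2 * INR n]
    makes the last term vanish. *)
Definition rho (delta : nat -> R) (n : nat) : R :=
  1 / 16 *
  (4 * Omega * delta (n + 1)%nat
   - (32 * INR n ^ 2 + 8 * INR n + 3) * delta n
   + (2 * INR n - 1) * (2 * INR n) * (4 * INR n - 1) * (4 * INR n - 3)
     * / Omega * delta (n - 1)%nat).

(* Main.v *)
Require Import Defs.
From Stdlib Require Import Reals.
From Coquelicot Require Import Coquelicot.
From Stdlib Require Import Arith Lra Lia.
Open Scope R_scope.

(** Termwise differentiation of the defining series gives
    [omega = x^2 theta'' + (3/2) x theta'].  Write [theta_tilde u = h (u^2)],
    where [h y] is [W] times the sum of [a_n y^n] and
    [a_n = delta n / (2n)! * Omega^n].  Under the substitution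
    [x = (1 - u) / (1 + u)] the Euler operator [x d/dx] becomes
    [- (1 - u^2) / 2 * d/du], and conjugation by [sqrt (1 + u)] subtracts
    [(1 - u) / 4] from it.  Expanding, with [g = theta_tilde],
<<
    omega_tilde = (1 - u^2)^2 / 4 g'' - 3/4 u (1 - u^2) g' - 3/16 (1 - u^2) g,
>>
    which in [y = u^2] is the second-order operator of
    [tilde_second_order_operator] applied to [h].  All its coefficients are
    polynomials of degree at most 3 in [y], and reading off the coefficient of
    [y^n] involves only [a_(n+1)], [a_n], [a_(n-1)]; the result is [rho]
    ([taylor_coef_rho], [is_pseries_rho]).

    Two points need separate care.  Termwise differentiation is reduced to
    that of power series: in the nome [q = exp (- PI x)] the theta series is a
    power series whose exponents are the squares, and [d/dx] acts on it as
    [- PI] times the Euler operator of [q].  Dividing by [Omega] requires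
    [Omega <> 0]; rather than evaluating the Gamma integral, one notes that
    [Omega = 0] would make [theta_tilde] constant, whereas [theta >= 1] forces
    [theta_tilde] to be unbounded near [u = -1] ([Omega_neq_0]). *)

(** Sums of series are stated in an abstract normed module; [ring] and
    [field] need the operations of [R] itself. *)
Ltac over_R :=
  match goal with |- @eq _ ?x ?y => change (@eq R x y) end;
  repeat match goal with
  | |- context [@plus ?G] => change (@plus G) with Rplus
  | |- context [@scal ?K ?V] => change (@scal K V) with Rmult
  | |- context [@zero ?G] => change (@zero G) with 0
  end.

(** [auto_derive] leaves derivatives at points that are only convertible to
    the point of the known derivative [H], so plain rewriting does not find
    them. *)
Ltac rewrite_derive H :=
  let T := type of H in
  lazymatch T with
  | is_derive ?f ?x ?l =>
    match goal with
    | |- context [Derive ?g ?z] =>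
      change (Derive g z) with (Derive f x);
      rewrite (is_derive_unique f x l H)
    end
  end.

Lemma Series_of_zeros (a : nat -> R) : (forall n, a n = 0) -> Series a = 0.
Proof.
  intros Ha. rewrite (Series_ext a (fun n => 0 * a n)).
  - rewrite Series_scal_l. ring.
  - intros n. rewrite (Ha n). ring.
Qed.

(** * The Euler operator on power series *)

(** The coefficients of [x * d/dx] applied to the power series of [a]. *)
Definition PS_euler (a : nat -> R) (n : nat) : R := INR n * a n.

Lemma PS_euler_eq (a : nat -> R) (n : nat) :
  PS_incr_1 (PS_derive a) n = PS_euler a n.
Proof.
  destruct n as [|n]; unfold PS_euler, PS_incr_1, PS_derive.
  - simpl. change (@zero R_NormedModule) with 0. ring.
  - reflexivity.
Qed.

Lemma CV_radius_euler (a : nat -> R) : CV_radius (PS_euler a) = CV_radius a.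
Proof.
  rewrite <- (CV_radius_derive a), <- (CV_radius_incr_1 (PS_derive a)).
  apply CV_radius_ext. intros n. symmetry. apply PS_euler_eq.
Qed.

Lemma is_pseries_PS_derive (a : nat -> R) (x : R) :
  Rbar_lt (Rabs x) (CV_radius a) ->
  is_pseries (PS_derive a) x (PSeries (PS_derive a) x).
Proof.
  intros Hx. apply PSeries_correct, ex_pseries_derive, Hx.
Qed.

Lemma is_pseries_euler (a : nat -> R) (x : R) :
  Rbar_lt (Rabs x) (CV_radius a) ->
  is_pseries (PS_euler a) x (x * PSeries (PS_derive a) x).
Proof.
  intros Hx.
  apply (is_pseries_ext _ _ _ _ (PS_euler_eq a)).
  apply (is_pseries_incr_1 (PS_derive a) x (PSeries (PS_derive a) x)).
  apply is_pseries_PS_derive, Hx.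
Qed.

(** [(x d/dx)^2 = x (d/dx + x d^2/dx^2)], in terms of the ordinary
    derivatives used everywhere else. *)
Lemma is_pseries_euler_twice (a : nat -> R) (x : R) :
  Rbar_lt (Rabs x) (CV_radius a) ->
  is_pseries (PS_euler (PS_euler a)) x
    (x * (PSeries (PS_derive a) x + x * PSeries (PS_derive (PS_derive a)) x)).
Proof.
  intros Hx.
  assert (Hx1 : Rbar_lt (Rabs x) (CV_radius (PS_derive a)))
    by (rewrite CV_radius_derive; exact Hx).
  apply (is_pseries_ext _ _ _ _ (PS_euler_eq (PS_euler a))).
  apply (is_pseries_incr_1 (PS_derive (PS_euler a)) x
    (PSeries (PS_derive a) x + x * PSeries (PS_derive (PS_derive a)) x)).
  apply (is_pseries_ext (PS_plus (PS_derive a) (PS_euler (PS_derive a)))).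
  - intros n. unfold PS_plus, PS_euler, PS_derive.
    over_R. rewrite S_INR. ring.
  - apply (is_pseries_plus (PS_derive a) (PS_euler (PS_derive a))).
    + apply is_pseries_PS_derive, Hx.
    + apply is_pseries_euler, Hx1.
Qed.

(** * Theta series as power series in the nome *)

Definition square_indicator (j : nat) : R :=
  if Nat.eqb (Nat.sqrt j * Nat.sqrt j) j then 1 else 0.

Lemma square_indicator_square (m : nat) : square_indicator (m * m) = 1.
Proof.
  unfold square_indicator. rewrite Nat.sqrt_square, Nat.eqb_refl. reflexivity.
Qed.

Lemma square_indicator_between (m d : nat) :
  (0 < d <= 2 * m)%nat -> square_indicator (m * m + d) = 0.
Proof.
  intros Hd. unfold square_indicator.
  rewrite (Nat.sqrt_unique (m * m + d) m) by lia.
  replace (Nat.eqb (m * m) (m * m + d)) with false; [reflexivity|].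
  symmetry. apply Nat.eqb_neq. lia.
Qed.

(** Between [n^2] and [(n+1)^2] there are exactly [2n] integers, and the
    sparse partial sums do not move there. *)
Lemma sum_over_squares (F : nat -> R) (m : nat) :
  sum_n (fun j => square_indicator j * F j) (m * m)
  = sum_n (fun k => F (k * k)%nat) m.
Proof.
  set (G := fun j => square_indicator j * F j).
  assert (Hgap : forall n d, (d <= 2 * n)%nat ->
            sum_n G (n * n + d) = sum_n G (n * n)).
  { intros n d. induction d as [|d IH]; intros Hd.
    - f_equal. lia.
    - rewrite Nat.add_succ_r, sum_Sn, IH by lia.
      unfold G at 2. rewrite <- Nat.add_succ_r, square_indicator_between by lia.
      over_R. ring. }
  induction m as [|m IH].
  - rewrite !sum_O.
    change (square_indicator (0 * 0) * F (0 * 0)%nat = F (0 * 0)%nat).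
    rewrite square_indicator_square. ring.
  - replace (S m * S m)%nat with (S (m * m + 2 * m)) by lia.
    rewrite !sum_Sn, Hgap, IH by lia.
    f_equal. unfold G. over_R.
    replace (S (m * m + 2 * m)) with (S m * S m)%nat by lia.
    rewrite square_indicator_square. ring.
Qed.

(** The partial sums of the series on the squares are a subsequence of those
    of the sparse series. *)
Lemma is_series_over_squares (F : nat -> R) (l : R) :
  is_series (fun j => square_indicator j * F j) l ->
  is_series (fun k => F (k * k)%nat) l.
Proof.
  intros H.
  apply (is_lim_seq_subseq _ l (fun m => (m * m)%nat)) in H.
  - apply (is_lim_seq_ext _ _ _ (sum_over_squares F) H).
  - apply eventually_subseq. intros n. nia.
Qed.

Definition moment_coef (i j : nat) : R := INR j ^ i * square_indicator j.

(** The Euler operator keeps the radius of convergence and raises the moment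
    by one, so only the bounded coefficients of moment 0 need an estimate. *)
Lemma CV_radius_moment_coef (i : nat) : Rbar_le 1 (CV_radius (moment_coef i)).
Proof.
  induction i as [|i IH].
  - apply (proj1 (CV_radius_bounded (moment_coef 0))).
    exists 1. intros n. unfold moment_coef, square_indicator.
    rewrite pow1. simpl.
    destruct (Nat.eqb _ _); rewrite ?Rmult_1_l, ?Rmult_1_r;
      rewrite ?Rabs_R1, ?Rabs_R0; lra.
  - rewrite (CV_radius_ext _ (PS_euler (moment_coef i))).
    + rewrite CV_radius_euler. exact IH.
    + intros n. unfold moment_coef, PS_euler. simpl. ring.
Qed.

(** The sum over [m >= 0] of [m^(2i) exp (- PI m^2 x)], defined as a power
    series in the nome so that it can be differentiated as such. *)
Definition theta_moment (i : nat) (x : R) : R :=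
  PSeries (moment_coef i) (exp (- (PI * x))).

Lemma nome_in_disk (i : nat) (x : R) : 0 < x ->
  Rbar_lt (Rabs (exp (- (PI * x)))) (CV_radius (moment_coef i)).
Proof.
  intros Hx.
  eapply Rbar_lt_le_trans; [|apply CV_radius_moment_coef].
  simpl. rewrite Rabs_pos_eq by (left; apply exp_pos).
  rewrite <- exp_0. apply exp_increasing.
  pose proof PI_RGT_0. nra.
Qed.

Lemma exp_pow_nat (x : R) (n : nat) : exp x ^ n = exp (INR n * x).
Proof.
  induction n as [|n IH].
  - simpl. rewrite Rmult_0_l, exp_0. reflexivity.
  - rewrite S_INR, Rmult_plus_distr_r, Rmult_1_l, exp_plus, <- IH. simpl. ring.
Qed.

Lemma is_series_theta_moment (i : nat) (x : R) : 0 < x ->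
  is_series (fun m => INR m ^ (2 * i) * exp (- PI * INR m ^ 2 * x))
    (theta_moment i x).
Proof.
  intros Hx.
  assert (H := PSeries_correct _ _ (CV_radius_inside _ _ (nome_in_disk i x Hx))).
  apply is_pseries_R in H.
  apply (is_series_ext _
    (fun j => square_indicator j * (INR j ^ i * exp (- (PI * x)) ^ j))) in H.
  2:{ intros n. unfold moment_coef. simpl. ring. }
  apply is_series_over_squares in H.
  revert H. apply is_series_ext. intros m.
  rewrite exp_pow_nat, mult_INR, (pow_mult (INR m)).
  f_equal; f_equal; ring.
Qed.

Lemma is_derive_theta_moment (i : nat) (x : R) : 0 < x ->
  is_derive (theta_moment i) x (- PI * theta_moment (S i) x).
Proof.
  intros Hx. unfold theta_moment.
  set (q := exp (- (PI * x))).
  assert (Hq := nome_in_disk i x Hx). fold q in Hq.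
  replace (- PI * PSeries (moment_coef (S i)) q)
    with (scal (- PI * q) (PSeries (PS_derive (moment_coef i)) q)).
  - apply (is_derive_comp (PSeries (moment_coef i)) (fun x => exp (- (PI * x)))).
    + apply is_derive_PSeries, Hq.
    + auto_derive; [exact I|]. unfold q. ring.
  - rewrite (PSeries_ext (moment_coef (S i)) (PS_euler (moment_coef i))).
    + rewrite (is_pseries_unique _ _ _ (is_pseries_euler _ _ Hq)).
      change scal with Rmult. simpl. ring.
    + intros n. unfold moment_coef, PS_euler. simpl. ring.
Qed.

(** The term [m = 0] is counted once in [theta] and twice in the double of the
    sum over [m >= 0]. *)
Lemma theta_eq_moment (x : R) : 0 < x -> theta x = 2 * theta_moment 0 x - 1.
Proof.
  intros Hx. unfold theta, ZSeries.
  assert (H := is_series_theta_moment 0 x Hx).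
  assert (H0 : Series (fun k => exp (- PI * INR k ^ 2 * x)) = theta_moment 0 x).
  { apply is_series_unique. revert H. apply is_series_ext.
    intros n. rewrite Nat.mul_0_r, pow_O. apply Rmult_1_l. }
  rewrite (Series_ext _ (fun k => exp (- PI * INR k ^ 2 * x))).
  2:{ intros n. rewrite <- INR_IZR_INZ. reflexivity. }
  rewrite (Series_ext (fun k => exp (- PI * IZR (- Z.of_nat (S k)) ^ 2 * x))
             (fun k => exp (- PI * INR (S k) ^ 2 * x))).
  2:{ intros n. rewrite opp_IZR, <- INR_IZR_INZ. f_equal. ring. }
  assert (H1 := H0). rewrite Series_incr_1 in H1.
  - replace (exp (- PI * INR 0 ^ 2 * x)) with 1 in H1.
    + lra.
    + symmetry. rewrite <- exp_0. f_equal. simpl. ring.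
  - exists (theta_moment 0 x). revert H. apply is_series_ext.
    intros n. rewrite Nat.mul_0_r, pow_O. apply Rmult_1_l.
Qed.

Lemma omega_eq_moment (x : R) : 0 < x ->
  omega x = 2 * PI ^ 2 * x ^ 2 * theta_moment 2 x - 3 * PI * x * theta_moment 1 x.
Proof.
  intros Hx. unfold omega. apply is_series_unique.
  set (t := fun m => (2 * PI ^ 2 * INR m ^ 4 * x ^ 2 - 3 * PI * INR m ^ 2 * x)
                     * exp (- PI * INR m ^ 2 * x)).
  apply (is_series_incr_1 t).
  replace (t 0%nat) with 0 by (unfold t; simpl; ring).
  rewrite (plus_zero_r (G := R_AbelianGroup)).
  assert (H2 := is_series_scal_l (2 * PI ^ 2 * x ^ 2) _ _
                  (is_series_theta_moment 2 x Hx)).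
  assert (H1 := is_series_scal_l (3 * PI * x) _ _
                  (is_series_theta_moment 1 x Hx)).
  assert (H := is_series_minus _ _ _ _ H2 H1).
  revert H. apply is_series_ext. intros n. unfold t.
  change (2 * PI ^ 2 * x ^ 2 * (INR n ^ 4 * exp (- PI * INR n ^ 2 * x))
    - 3 * PI * x * (INR n ^ 2 * exp (- PI * INR n ^ 2 * x)) =
   (2 * PI ^ 2 * INR n ^ 4 * x ^ 2 - 3 * PI * INR n ^ 2 * x) *
   exp (- PI * INR n ^ 2 * x)). ring.
Qed.

Lemma theta_ge_1 (x : R) : 0 < x -> 1 <= theta x.
Proof.
  intros Hx. rewrite (theta_eq_moment x Hx).
  assert (H := is_series_theta_moment 0 x Hx).
  rewrite <- (is_series_unique _ _ H), Series_incr_1 by (eexists; exact H).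
  assert (0 <= Series (fun k => INR (S k) ^ (2 * 0) * exp (- PI * INR (S k) ^ 2 * x))).
  { rewrite <- (Series_of_zeros (fun _ => 0)) by reflexivity.
    apply Series_le.
    - intros n. split; [lra|]. rewrite Nat.mul_0_r, pow_O, Rmult_1_l.
      left; apply exp_pos.
    - apply (ex_series_incr_1
        (fun k => INR k ^ (2 * 0) * exp (- PI * INR k ^ 2 * x))).
      eexists; exact H. }
  replace (exp (- PI * INR 0 ^ 2 * x)) with 1.
  - rewrite Nat.mul_0_r, pow_O in *. lra.
  - symmetry. rewrite <- exp_0. f_equal. simpl. ring.
Qed.

(** * The differential operator in the disk variable *)

Lemma disk_point_pos (u : R) : Rabs u < 1 -> 0 < (1 - u) / (1 + u).
Proof.
  intros Hu. apply Rabs_def2 in Hu. apply Rdiv_lt_0_compat; lra.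
Qed.

Lemma locally_disk (u : R) : Rabs u < 1 -> locally u (fun v => Rabs v < 1).
Proof.
  intros Hu.
  apply (locally_open (fun v => Rabs v < 1)); auto.
  apply (open_comp Rabs (fun v => v < 1)); [|apply open_lt].
  intros v _. apply continuous_Rabs.
Qed.

(** Functional equations on the open disk may be differentiated. *)
Lemma is_derive_eq_on_disk (f g : R -> R) (u df dg : R) :
  Rabs u < 1 -> (forall v, Rabs v < 1 -> f v = g v) ->
  is_derive f u df -> is_derive g u dg -> df = dg.
Proof.
  intros Hu Hfg Hf Hg.
  rewrite <- (is_derive_unique _ _ _ Hf), <- (is_derive_unique _ _ _ Hg).
  apply Derive_ext_loc.
  apply (filter_imp _ _ Hfg), locally_disk, Hu.
Qed.

(** Conjugating [x^2 d^2/dx^2 + (3/2) x d/dx] by [tilde].  The equation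
    [f ((1 - u) / (1 + u)) = sqrt (1 + u) * h (u^2)] holds on the whole disk,
    so it can be differentiated twice ([E1], [E2]); these two derivatives
    determine [f1] and [f2] at [(1 - u) / (1 + u)] in terms of [h], [h1] and
    [h2].  Writing the even function as [h (u^2)] keeps the conclusion in the
    variable of the Taylor expansion; that the odd powers of [u] cancel in it
    is what singles out the factor [3 / 2]. *)
Lemma tilde_second_order_operator (f f1 f2 h h1 h2 : R -> R) :
  (forall x, 0 < x -> is_derive f x (f1 x)) ->
  (forall x, 0 < x -> is_derive f1 x (f2 x)) ->
  (forall y, Rabs y < 1 -> is_derive h y (h1 y)) ->
  (forall y, Rabs y < 1 -> is_derive h1 y (h2 y)) ->
  (forall u, Rabs u < 1 -> tilde f u = h (u ^ 2)) ->
  forall u, Rabs u < 1 ->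
  tilde (fun x => x ^ 2 * f2 x + 3 / 2 * x * f1 x) u
  = (1 - u ^ 2) ^ 2 * (h1 (u ^ 2) / 2 + u ^ 2 * h2 (u ^ 2))
    - 3 / 2 * u ^ 2 * (1 - u ^ 2) * h1 (u ^ 2)
    - 3 / 16 * (1 - u ^ 2) * h (u ^ 2).
Proof.
  intros Df Df1 Dh Dh1 Hfh.
  assert (Hsq : forall u, Rabs u < 1 -> Rabs (u ^ 2) < 1).
  { intros u Hu. apply Rabs_def2 in Hu. rewrite Rabs_pos_eq by nra. nra. }
  assert (E0 : forall u, Rabs u < 1 ->
    f ((1 - u) / (1 + u)) = sqrt (1 + u) * h (u ^ 2)).
  { intros u Hu. rewrite <- Hfh by exact Hu. unfold tilde.
    apply Rabs_def2 in Hu.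
    assert (0 < sqrt (1 + u)) by (apply sqrt_lt_R0; lra).
    field. lra. }
  assert (E1 : forall u, Rabs u < 1 ->
    - 2 / (1 + u) ^ 2 * f1 ((1 - u) / (1 + u))
    = sqrt (1 + u) * (2 * u * h1 (u ^ 2) + h (u ^ 2) / (2 * (1 + u)))).
  { intros u Hu. apply (is_derive_eq_on_disk _ _ u _ _ Hu E0).
    - assert (Hx := Df _ (disk_point_pos u Hu)).
      apply Rabs_def2 in Hu.
      auto_derive; [repeat split; try lra; eexists; exact Hx|].
      rewrite_derive Hx.
      change ((1 + - u) * / (1 + u)) with ((1 - u) / (1 + u)).
      field. lra.
    - assert (Hy := Dh _ (Hsq u Hu)).
      apply Rabs_def2 in Hu.
      assert (0 < sqrt (1 + u)) by (apply sqrt_lt_R0; lra).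
      assert (Hs : sqrt (1 + u) * sqrt (1 + u) = 1 + u) by (apply sqrt_sqrt; lra).
      auto_derive; [repeat split; try lra; eexists; exact Hy|].
      rewrite_derive Hy.
      change (u * (u * 1)) with (u ^ 2).
      (* After multiplication by [sqrt (1 + u)] the root occurs only squared. *)
      apply (Rmult_eq_reg_l (sqrt (1 + u))); [|lra].
      transitivity (h (u ^ 2) / 2
        + sqrt (1 + u) * sqrt (1 + u) * (2 * u * h1 (u ^ 2))).
      + field. lra.
      + transitivity (sqrt (1 + u) * sqrt (1 + u)
          * (2 * u * h1 (u ^ 2) + h (u ^ 2) / (2 * (1 + u)))); [|ring].
        rewrite Hs. field. lra. }
  assert (E2 : forall u, Rabs u < 1 ->
    4 / (1 + u) ^ 3 * f1 ((1 - u) / (1 + u))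
    + 4 / (1 + u) ^ 4 * f2 ((1 - u) / (1 + u))
    = sqrt (1 + u) *
      ((2 * u * h1 (u ^ 2) + h (u ^ 2) / (2 * (1 + u))) / (2 * (1 + u))
       + 2 * h1 (u ^ 2) + 4 * u ^ 2 * h2 (u ^ 2)
       + u * h1 (u ^ 2) / (1 + u) - h (u ^ 2) / (2 * (1 + u) ^ 2))).
  { intros u Hu. apply (is_derive_eq_on_disk _ _ u _ _ Hu E1).
    - assert (Hx := Df1 _ (disk_point_pos u Hu)).
      apply Rabs_def2 in Hu.
      auto_derive; [repeat split; try nra; eexists; exact Hx|].
      rewrite_derive Hx.
      change ((1 + - u) * / (1 + u)) with ((1 - u) / (1 + u)).
      field. lra.
    - assert (Hy := Dh _ (Hsq u Hu)).
      assert (Hy1 := Dh1 _ (Hsq u Hu)).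
      apply Rabs_def2 in Hu.
      assert (0 < sqrt (1 + u)) by (apply sqrt_lt_R0; lra).
      assert (Hs : sqrt (1 + u) * sqrt (1 + u) = 1 + u) by (apply sqrt_sqrt; lra).
      auto_derive; [repeat split; try lra; eexists; [exact Hy1|exact Hy]|].
      rewrite_derive Hy.
      rewrite_derive Hy1.
      change (u * (u * 1)) with (u ^ 2).
      apply (Rmult_eq_reg_l (sqrt (1 + u))); [|lra].
      set (k := 2 * u * h1 (u ^ 2) + h (u ^ 2) / (2 * (1 + u))).
      set (k1 := 2 * h1 (u ^ 2) + 4 * u ^ 2 * h2 (u ^ 2)
         + u * h1 (u ^ 2) / (1 + u) - h (u ^ 2) / (2 * (1 + u) ^ 2)).
      transitivity (k / 2 + sqrt (1 + u) * sqrt (1 + u) * k1).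
      + unfold k, k1. field. lra.
      + transitivity (sqrt (1 + u) * sqrt (1 + u) * (k / (2 * (1 + u)) + k1)).
        * rewrite Hs. field. lra.
        * unfold k1. ring. }
  intros u Hu. specialize (E1 u Hu). specialize (E2 u Hu).
  unfold tilde.
  apply Rabs_def2 in Hu.
  assert (0 < sqrt (1 + u)) by (apply sqrt_lt_R0; lra).
  set (X := (1 - u) / (1 + u)) in *.
  assert (F1 : f1 X = sqrt (1 + u) * (- (1 + u) ^ 2 / 2 *
     (2 * u * h1 (u ^ 2) + h (u ^ 2) / (2 * (1 + u))))).
  { transitivity (- (1 + u) ^ 2 / 2 * (- 2 / (1 + u) ^ 2 * f1 X)).
    - field. lra.
    - rewrite E1. field. lra. }
  assert (F2 : f2 X = (1 + u) ^ 4 / 4 *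
     (4 / (1 + u) ^ 3 * f1 X + 4 / (1 + u) ^ 4 * f2 X) - (1 + u) * f1 X).
  { field. lra. }
  rewrite E2, F1 in F2. rewrite F1, F2. unfold X. field. lra.
Qed.

(** * Taylor coefficients *)

Definition taylor_coef (c : nat -> R) (n : nat) : R :=
  c n / INR (fact (2 * n)) * Omega ^ n.

Lemma taylor_term_coef (c : nat -> R) (u : R) (n : nat) :
  taylor_term c u n = taylor_coef c n * (u ^ 2) ^ n.
Proof.
  unfold taylor_term, taylor_coef. rewrite pow_mult. reflexivity.
Qed.

(** If [Omega] vanished, only the term [n = 0] of the expansion would remain
    and [theta_tilde] would be constant; but [theta_tilde u] is at least
    [1 / sqrt (1 + u)]. *)
Lemma Omega_neq_0 (delta : nat -> R) :
  has_taylor_expansion theta_tilde delta -> Omega <> 0.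
Proof.
  intros H H0.
  assert (Hconst : forall u, Rabs u < 1 -> theta_tilde u = W * delta 0%nat).
  { intros u Hu. destruct (H u Hu) as [Hex ->]. f_equal.
    rewrite Series_incr_1 by exact Hex.
    rewrite (Series_of_zeros (fun k => taylor_term delta u (S k))).
    - unfold taylor_term. simpl. field.
    - intros n. unfold taylor_term. rewrite H0. simpl. ring. }
  set (M := W * delta 0%nat) in *.
  assert (Hd : 0 < / (M ^ 2 + 2) < 1).
  { split; [apply Rinv_0_lt_compat; nra|].
    apply (Rmult_lt_reg_l (M ^ 2 + 2)); [nra|]. rewrite Rinv_r by nra. nra. }
  (* At this point [1 / sqrt (1 + u)] is [sqrt (M^2 + 2)], which exceeds [M]. *)
  set (u := -1 + / (M ^ 2 + 2)).
  assert (Hu : Rabs u < 1) by (apply Rabs_def1; unfold u; lra).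
  assert (Hth := theta_ge_1 _ (disk_point_pos u Hu)).
  specialize (Hconst u Hu). unfold theta_tilde, tilde in Hconst.
  replace (sqrt (1 + u)) with (/ sqrt (M ^ 2 + 2)) in Hconst.
  2:{ rewrite <- sqrt_inv. f_equal. unfold u. ring. }
  rewrite Rinv_inv in Hconst.
  assert (Hs : sqrt (M ^ 2 + 2) * sqrt (M ^ 2 + 2) = M ^ 2 + 2)
    by (apply sqrt_sqrt; nra).
  assert (Hs0 := sqrt_pos (M ^ 2 + 2)).
  apply (Rmult_le_compat_l _ _ _ Hs0) in Hth.
  rewrite Hconst in Hth.
  nra.
Qed.

(** The recurrence defining [rho] regrouped by operators: with
    [E = y d/dy] and [h] the sum of the series of [a], the right-hand side lists the coefficients of
    [h'/2 + E h' - 2 E^2 h - E h / 2 - 3/16 h + y (E^2 h + E h + 3/16 h)].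
    The shift by one turns [(4n - 1)(4n - 3)] into
    [16 m^2 + 16 m + 3] with [m = n - 1]. *)
Lemma taylor_coef_rho (delta : nat -> R) (n : nat) : Omega <> 0 ->
  let a := taylor_coef delta in
  taylor_coef (rho delta) n
  = 1 / 2 * PS_derive a n + PS_euler (PS_derive a) n
    - 2 * PS_euler (PS_euler a) n - 1 / 2 * PS_euler a n - 3 / 16 * a n
    + PS_incr_1 (fun m => PS_euler (PS_euler a) m + PS_euler a m + 3 / 16 * a m) n.
Proof.
  intros HO a.
  assert (Hfact : forall k, INR (fact (2 * S k))
    = (2 * INR k + 2) * (2 * INR k + 1) * INR (fact (2 * k))).
  { intros k. replace (2 * S k)%nat with (S (S (2 * k))) by lia.
    rewrite !fact_simpl, !mult_INR, !S_INR, mult_INR. simpl (INR 2). ring. }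
  assert (Hpos : forall k, INR (fact k) <> 0) by apply INR_fact_neq_0.
  assert (Hk : forall k, 0 <= INR k) by apply pos_INR.
  unfold PS_derive, PS_euler, PS_incr_1, a, taylor_coef, rho.
  rewrite (Nat.add_1_r n).
  destruct n as [|n].
  - change (@zero R_NormedModule) with 0. simpl. field. exact HO.
  - replace (S n - 1)%nat with n by lia.
    specialize (Hpos (2 * n)%nat). specialize (Hk n).
    rewrite !Hfact, !S_INR. simpl (Omega ^ _).
    field. repeat split; auto; lra.
Qed.

(** The operator of [tilde_second_order_operator] read on coefficients: with [h]
    and [E] as for [taylor_coef_rho], and [E h = y h'], [E h' = y h''] and [E^2 h = y (h' + y h'')] the regrouped
    operator there is the one displayed here. *)
Lemma is_pseries_rho (delta : nat -> R) (y : R) :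
  let a := taylor_coef delta in
  let h1 := PSeries (PS_derive a) y in
  let h2 := PSeries (PS_derive (PS_derive a)) y in
  Omega <> 0 -> Rbar_lt (Rabs y) (CV_radius a) ->
  is_pseries (taylor_coef (rho delta)) y
    ((1 - y) ^ 2 * (h1 / 2 + y * h2)
     - 3 / 2 * y * (1 - y) * h1 - 3 / 16 * (1 - y) * PSeries a y).
Proof.
  intros a h1 h2 HO Hy.
  assert (Hy1 : Rbar_lt (Rabs y) (CV_radius (PS_derive a)))
    by (rewrite CV_radius_derive; exact Hy).
  assert (S0 := PSeries_correct _ _ (CV_radius_inside _ _ Hy)).
  assert (S1 := is_pseries_PS_derive _ _ Hy).
  assert (S2 := is_pseries_euler _ _ Hy1).
  assert (S3 := is_pseries_euler _ _ Hy).
  assert (S4 := is_pseries_euler_twice _ _ Hy).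
  fold h1 in S1, S3, S4. fold h2 in S2, S4.
  assert (Sc : forall (c : R) (b : nat -> R) (l : R),
    is_pseries b y l -> is_pseries (PS_scal c b) y (c * l)).
  { intros c b l Hb. apply (is_pseries_scal c b y l); [apply Rmult_comm|exact Hb]. }
  assert (T := is_pseries_incr_1 _ _ _
    (is_pseries_plus _ _ _ _ _ (is_pseries_plus _ _ _ _ _ S4 S3)
      (Sc (3 / 16) _ _ S0))).
  assert (T' := is_pseries_plus _ _ _ _ _
    (is_pseries_plus _ _ _ _ _
      (is_pseries_plus _ _ _ _ _
        (is_pseries_plus _ _ _ _ _
          (is_pseries_plus _ _ _ _ _ (Sc (1 / 2) _ _ S1) S2)
          (Sc (- 2) _ _ S4))
        (Sc (- (1 / 2)) _ _ S3))
      (Sc (- (3 / 16)) _ _ S0))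
    T).
  apply (is_pseries_ext _ (taylor_coef (rho delta))) in T'.
  - match type of T' with is_pseries _ _ ?l =>
      replace ((1 - y) ^ 2 * (h1 / 2 + y * h2) - 3 / 2 * y * (1 - y) * h1
               - 3 / 16 * (1 - y) * PSeries a y) with l; [exact T'|] end.
    over_R. field.
  - intros n. rewrite (taylor_coef_rho delta n HO). fold a.
    unfold PS_plus, PS_scal. destruct n as [|n]; simpl; over_R; field.
Qed.

(** An expansion valid for all [|u| < 1] converges at every [y = u^2] in
    [[0, 1)], which leaves no room for a radius below 1. *)
Lemma CV_radius_taylor_coef (f : R -> R) (c : nat -> R) :
  has_taylor_expansion f c -> Rbar_le 1 (CV_radius (taylor_coef c)).
Proof.
  intros H. apply Rbar_not_lt_le. intros Hlt.
  assert (H0 := CV_radius_ge_0 (taylor_coef c)).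
  destruct (CV_radius (taylor_coef c)) as [r| |] eqn:Er; simpl in *; try tauto.
  set (y := (r + 1) / 2).
  assert (Hy : r < y < 1) by (unfold y; lra).
  assert (Hy2 : sqrt y ^ 2 = y) by (apply pow2_sqrt; lra).
  assert (Hu : Rabs (sqrt y) < 1).
  { rewrite Rabs_pos_eq by apply sqrt_pos.
    rewrite <- sqrt_1. apply sqrt_lt_1; lra. }
  apply (CV_disk_outside (taylor_coef c) y).
  - rewrite Er. simpl. rewrite Rabs_pos_eq; lra.
  - apply ex_series_lim_0.
    apply (ex_series_ext (taylor_term c (sqrt y))).
    + intros n. rewrite taylor_term_coef, Hy2. reflexivity.
    + apply (H _ Hu).
Qed.

Theorem theorem6p3 (delta : nat -> R)
  (hdelta : has_taylor_expansion theta_tilde delta) :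
  has_taylor_expansion omega_tilde (rho delta).
Proof.
  assert (HO := Omega_neq_0 delta hdelta).
  set (a := taylor_coef delta).
  assert (Ha : forall y, Rabs y < 1 -> Rbar_lt (Rabs y) (CV_radius a)).
  { intros y Hy. eapply Rbar_lt_le_trans; [|apply (CV_radius_taylor_coef _ _ hdelta)].
    exact Hy. }
  set (h1 := PSeries (PS_derive a)).
  set (h2 := PSeries (PS_derive (PS_derive a))).
  assert (Hop := tilde_second_order_operator theta
    (fun x => - 2 * PI * theta_moment 1 x)
    (fun x => 2 * PI ^ 2 * theta_moment 2 x)
    (fun y => W * PSeries a y) (fun y => W * h1 y) (fun y => W * h2 y)).
  intros u Hu.
  assert (Hy : Rabs (u ^ 2) < 1).
  { apply Rabs_def2 in Hu. rewrite Rabs_pos_eq by nra. nra. }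
  set (y := u ^ 2) in *.
  assert (Hrho : is_series (taylor_term (rho delta) u)
    ((1 - y) ^ 2 * (h1 y / 2 + y * h2 y)
     - 3 / 2 * y * (1 - y) * h1 y - 3 / 16 * (1 - y) * PSeries a y)).
  { apply (is_series_ext (fun n => taylor_coef (rho delta) n * y ^ n)).
    { intros n. symmetry. apply taylor_term_coef. }
    apply is_pseries_R, is_pseries_rho; [exact HO|]. apply Ha, Hy. }
  split; [eexists; exact Hrho|].
  rewrite (is_series_unique _ _ Hrho).
  transitivity (tilde (fun x => x ^ 2 * (2 * PI ^ 2 * theta_moment 2 x)
    + 3 / 2 * x * (- 2 * PI * theta_moment 1 x)) u).
  - unfold omega_tilde, tilde. f_equal.
    rewrite omega_eq_moment by (apply disk_point_pos, Hu). field.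
    apply Rabs_def2 in Hu. lra.
  - rewrite Hop; clear Hop; try exact Hu.
    + fold y. field.
    + intros x Hx.
      apply (is_derive_ext_loc (fun x => 2 * theta_moment 0 x - 1)).
      * apply (locally_open (fun x => 0 < x)); [apply open_gt| |exact Hx].
        intros z Hz. symmetry. apply theta_eq_moment, Hz.
      * auto_derive; [eexists; apply is_derive_theta_moment, Hx|].
        rewrite_derive (is_derive_theta_moment 0 x Hx). ring.
    + intros x Hx.
      auto_derive; [eexists; apply is_derive_theta_moment, Hx|].
      rewrite_derive (is_derive_theta_moment 1 x Hx). ring.
    + intros z Hz. apply (is_derive_scal (PSeries a)).
      apply is_derive_PSeries, Ha, Hz.
    + intros z Hz. apply (is_derive_scal h1).
      apply is_derive_PSeries. rewrite CV_radius_derive. apply Ha, Hz.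
    + intros v Hv. destruct (hdelta v Hv) as [_ Hv']. fold theta_tilde.
      rewrite Hv'. f_equal. apply Series_ext. intros n. apply taylor_term_coef.
Qed.
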